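(* Let $\mathfrak g=\mathfrak g_3\oplus\mathfrak g_1$ be a real Lie algebra, where $\mathfrak g_3$ is a solvable indecomposable three-dimensional real Lie algebra and $\mathfrak g_1=\mathbb R$. Then any two generating two-dimensional subspaces of $\mathfrak g$ are transformed into each other by some automorphism of $\mathfrak g$.
   Context: A subspace is generating if the smallest Lie subalgebra containing it is $\mathfrak g$. A Lie algebra is indecomposable if it is not a direct sum of two nonzero ideals. *)

(* Defs.v *)
From HB Require Import structures.
From mathcomp Require Import all_boot all_order all_algebra.
From mathcomp Require Import reals.

Set Implicit Arguments.
Unset Strict Implicit.
Unset Printing Implicit Defensive.

Import GRing.Theory.
Local Open Scope ring_scope.

HB.mixin Record isLieAlgebra (K : fieldType) (V : Type) of Vector K V := {
  lie : V -> V -> V;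
  lie_linearl : forall y : V, linear (fun x : V => lie x y);
  lie_linearr : forall x : V, linear (fun y : V => lie x y);
  liexx : forall x : V, lie x x = 0;
  lie_jacobi : forall x y z : V,
    lie x (lie y z) + lie y (lie z x) + lie z (lie x y) = 0
}.

#[short(type="lieAlgType")]
HB.structure Definition LieAlgebra (K : fieldType) :=
  {V of isLieAlgebra K V & Vector K V}.

Section DirectSum.
Variables (K : fieldType) (L1 L2 : lieAlgType K).

Definition prod_lie (x y : L1 * L2) : L1 * L2 :=
  (lie x.1 y.1, lie x.2 y.2).

Fact prod_lie_linearl (y : L1 * L2) : linear (fun x => prod_lie x y).
Proof. by move=> a u v; rewrite /prod_lie /= !lie_linearl. Qed.

Fact prod_lie_linearr (x : L1 * L2) : linear (fun y => prod_lie x y).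
Proof. by move=> a u v; rewrite /prod_lie /= !lie_linearr. Qed.

Fact prod_liexx (x : L1 * L2) : prod_lie x x = 0.
Proof. by rewrite /prod_lie !liexx. Qed.

Fact prod_lie_jacobi (x y z : L1 * L2) :
  prod_lie x (prod_lie y z) + prod_lie y (prod_lie z x)
    + prod_lie z (prod_lie x y) = 0.
Proof. by congr pair; rewrite /= lie_jacobi. Qed.

(* The direct sum of two Lie algebras is carried by the product type. *)
HB.instance Definition _ := isLieAlgebra.Build K (L1 * L2)%type
  prod_lie_linearl prod_lie_linearr prod_liexx prod_lie_jacobi.

End DirectSum.

Section Line.
Variable K : fieldType.

Definition line_lie (x y : K^o) : K^o := 0.

Fact line_lie_linearl (y : K^o) : linear (fun x => line_lie x y).
Proof. by move=> a u v; rewrite /line_lie scaler0 addr0. Qed.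

Fact line_lie_linearr (x : K^o) : linear (fun y => line_lie x y).
Proof. by move=> a u v; rewrite /line_lie scaler0 addr0. Qed.

Fact line_liexx (x : K^o) : line_lie x x = 0.
Proof. by []. Qed.

Fact line_lie_jacobi (x y z : K^o) :
  line_lie x (line_lie y z) + line_lie y (line_lie z x)
    + line_lie z (line_lie x y) = 0.
Proof. by rewrite /line_lie !addr0. Qed.

HB.instance Definition _ := isLieAlgebra.Build K K^o
  line_lie_linearl line_lie_linearr line_liexx line_lie_jacobi.

End Line.

Section LieTheory.
Variables (K : fieldType) (L : lieAlgType K).
Implicit Types U V H I J : {vspace L}.

Definition lie_subalgebra H : Prop :=
  forall x y, x \in H -> y \in H -> lie x y \in H.

Definition lie_ideal I : Prop :=
  forall x y, y \in I -> lie x y \in I.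

Definition lie_hull V H : Prop :=
  [/\ lie_subalgebra H, (V <= H)%VS &
      forall H', lie_subalgebra H' -> (V <= H')%VS -> (H <= H')%VS].

Definition generating V : Prop := lie_hull V fullv.

(* The span of all brackets of an element of U with an element of V; by
   bilinearity bases suffice, see lie_prod_sub below. *)
Definition lie_prod U V : {vspace L} :=
  <<[seq lie u v | u <- vbasis U, v <- vbasis V]>>%VS.

Definition derived_series (n : nat) : {vspace L} :=
  iter n (fun U => lie_prod U U) fullv.

Definition lie_solvable : Prop := exists n, derived_series n = 0%VS.

Definition lie_indecomposable : Prop :=
  ~ exists I J : {vspace L},
      [/\ lie_ideal I, lie_ideal J, I <> 0%VS & J <> 0%VS] /\
      (I + J)%VS = fullv /\ (I :&: J)%VS = 0%VS.

Definition lie_automorphism (f : 'End(L)) : Prop :=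
  bijective f /\ forall x y, f (lie x y) = lie (f x) (f y).

HB.instance Definition _ (x : L) :=
  GRing.isLinear.Build K L L *:%R (lie x) (lie_linearr x).

Definition lie_swap (y x : L) : L := lie x y.

HB.instance Definition _ (y : L) :=
  GRing.isLinear.Build K L L *:%R (lie_swap y) (lie_linearl y).

Lemma lie_prod_sub U V W :
  (lie_prod U V <= W)%VS <-> forall u v, u \in U -> v \in V -> lie u v \in W.
Proof.
split=> [/subvP sW u v Uu Vv | sW].
  rewrite (coord_vbasis Vv) linear_sum rpred_sum// => j _.
  rewrite linearZ rpredZ//= -[lie u _]/(lie_swap _ u).
  rewrite (coord_vbasis Uu) linear_sum rpred_sum// => i _.
  rewrite linearZ rpredZ//=; apply/sW/memv_span/allpairsP.
  exists ((vbasis U)`_i, (vbasis V)`_j); split=> //.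
    by rewrite mem_nth ?size_tuple.
  by rewrite mem_nth ?size_tuple.
apply/span_subvP=> _ /allpairsP[[u v] [Uu Vv ->]].
by apply: sW; apply: vbasis_mem.
Qed.

End LieTheory.

(* Main.v *)
(** Let D = [g3, g3]. A generating plane V satisfies V + (D x 0) = g3 + R, so
  dim D >= 2, and solvability gives dim D = 2. Fix e outside D. Then V is
  spanned by some (x, 0) and (w, 1) with x in e + D and w in D, and w is a
  cyclic vector of ad x on D: otherwise (x, 0), (0, 1), (w, 0) span a proper
  subalgebra containing V. The Jacobi identity then forces D to be abelian, so
  ad x on D depends only on e. Hence for two generating planes the linear map
  x, w, [x, w] |-> x', w', [x', w'] is an automorphism of g3, and its sum with
  the identity of R carries one plane to the other. *)
From HB Require Import structures.
Require Import Defs.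
From mathcomp Require Import all_boot all_order all_algebra.
From mathcomp Require Import reals.

Set Implicit Arguments.
Unset Strict Implicit.
Unset Printing Implicit Defensive.

Import GRing.Theory.

(** * Coordinates in spans of two and three vectors *)

Section Span.
Local Open Scope ring_scope.
Context {K : fieldType} {vT : vectType K}.
Implicit Types u v w : vT.

Lemma span2P u v w :
  w \in <<[:: u; v]>>%VS -> exists a b, w = a *: u + b *: v.
Proof.
rewrite span_cons span_seq1 => /memv_addP[_ /vlineP[a ->] [_ /vlineP[b ->] ->]].
by exists a, b.
Qed.

Lemma span3P u v w z : z \in <<[:: u; v; w]>>%VS ->
  exists a b c, z = a *: u + b *: v + c *: w.
Proof.
rewrite span_cons => /memv_addP[_ /vlineP[a ->] [y /span2P[b [c ->]] ->]].
by exists a, b, c; rewrite addrA.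
Qed.

Lemma free2_eq0 u v a b :
  free [:: u; v] -> a *: u + b *: v = 0 -> a = 0 /\ b = 0.
Proof.
move=> /(freeP (X := [tuple u; v]))/(_ (fun i => if val i == 0%N then a else b)).
rewrite !big_ord_recl big_ord0 addr0 /= => /[apply] ab0.
by have := ab0 ord0; have := ab0 ord_max.
Qed.

End Span.

(** * Brackets and cyclic frames in a three-dimensional Lie algebra *)

Section Lie.
Local Open Scope ring_scope.
Context {K : fieldType} {L : lieAlgType K}.
Implicit Types x y z w : L.

Lemma lieDl x y z : lie (x + y) z = lie x z + lie y z.
Proof. exact: (linearD (lie_swap z)). Qed.

Lemma lieZl a x z : lie (a *: x) z = a *: lie x z.
Proof. exact: (linearZ_LR (lie_swap z)). Qed.

Lemma lieDr x y z : lie x (y + z) = lie x y + lie x z.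
Proof. exact: linearD. Qed.

Lemma lieZr a x z : lie x (a *: z) = a *: lie x z.
Proof. exact: linearZ_LR. Qed.

Lemma lie0r x : lie x 0 = 0.
Proof. exact: linear0. Qed.

Lemma lieC x y : lie y x = - lie x y.
Proof.
have := liexx (x + y); rewrite lieDl !lieDr !liexx add0r addr0 addrC.
by move/eqP; rewrite addr_eq0 => /eqP.
Qed.

Lemma mem_lie_prod (U V : {vspace L}) x y :
  x \in U -> y \in V -> lie x y \in lie_prod U V.
Proof. exact: (lie_prod_sub U V _).1 (subvv _) x y. Qed.

(** The coefficients are the 2 by 2 minors, so a bracket computation in a frame reduces to its three
    basic brackets. *)
Lemma lie_comb3 x y z a b c a' b' c' :
  lie (a *: x + b *: y + c *: z) (a' *: x + b' *: y + c' *: z) =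
  (a * b' - b * a') *: lie x y + (a * c' - c * a') *: lie x z
    + (b * c' - c * b') *: lie y z.
Proof.
rewrite !(lieDl, lieDr, lieZl, lieZr) !liexx !scaler0 (lieC x y) (lieC x z).
rewrite (lieC y z) !add0r !addr0 !scalerDr !scalerN !scalerA !scalerBl.
exact: (AC (2*2*2) ((1*3)*(2*5)*(4*6))).
Qed.

(** The vector [w] is cyclic for [ad x] on a derived algebra of dimension two, and [x] lies outside
    that algebra. *)
Definition cyclic_frame x w : Prop :=
  free [:: x; w; lie x w] /\ lie_prod fullv fullv = <<[:: w; lie x w]>>%VS.

Context (dimL : \dim (fullv : {vspace L}) = 3%N).

Lemma frame_full x w :
  free [:: x; w; lie x w] -> <<[:: x; w; lie x w]>>%VS = fullv.
Proof.
by move=> fr; apply/eqP; rewrite eqEdim subvf dimL (eqP fr).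
Qed.

Lemma frame_abelian x w : cyclic_frame x w -> lie w (lie x w) = 0.
Proof.
case=> fr defD; have full_frame := frame_full fr.
have fr2 : free [:: w; lie x w] by move: fr; rewrite free_cons => /andP[].
have [l [m def_wv]] : exists l m, lie w (lie x w) = l *: w + m *: lie x w.
  by apply: span2P; rewrite -defD mem_lie_prod ?memvf.
have [g [d def_xv]] : exists g d, lie x (lie x w) = g *: w + d *: lie x w.
  by apply: span2P; rewrite -defD mem_lie_prod ?memvf.
(* The Jacobi identity for [x], [w], [[x, w]] reads [(m g - d l) w + l [x, w] = 0]. *)
have [|mg l0] := @free2_eq0 _ _ w (lie x w) (m * g - d * l) l fr2.
  rewrite -[RHS](lie_jacobi x w (lie x w)) liexx addr0 def_wv.
  rewrite (lieC x (lie x w)) def_xv -scaleN1r lieZr !lieDr !lieZr liexx def_xv.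
  rewrite def_wv scaler0 add0r scaleN1r !scalerDr !scalerA scalerBl opprD.
  rewrite [d * m]mulrC.
  by rewrite [RHS](AC ((1*2)*2) (((2*4)*1)*(3*5))) /= subrr addr0.
have {}mg : m * g = 0 by rewrite -mg l0 mulr0 subr0.
rewrite def_wv l0 scale0r add0r.
have [->|m_neq0] := eqVneq m 0; first by rewrite scale0r.
have g0 : g = 0 by move/eqP: mg; rewrite mulf_eq0 (negPf m_neq0) => /eqP.
(* With [l = g = 0] all three basic brackets are multiples of [[x, w]], so the derived algebra would
   be a line, against the freeness of [w], [[x, w]]. *)
have sDv : (lie_prod (fullv : {vspace L}) fullv <= <[lie x w]>)%VS.
  apply/lie_prod_sub => y z _ _.
  have /span3P[a [b [c ->]]] : y \in <<[:: x; w; lie x w]>>%VS.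
    by rewrite full_frame memvf.
  have /span3P[a' [b' [c' ->]]] : z \in <<[:: x; w; lie x w]>>%VS.
    by rewrite full_frame memvf.
  rewrite lie_comb3 def_wv def_xv l0 g0 !scale0r !add0r !scalerA -!scalerDl.
  exact: memvZ (memv_line _).
have: w \in <[lie x w]>%VS.
  by apply: (subvP sDv); rewrite defD memv_span ?inE ?eqxx.
by move: fr2; rewrite free_cons span_seq1 => /andP[/negPf->].
Qed.

Lemma derived_abelian x w y z : cyclic_frame x w ->
  y \in lie_prod (fullv : {vspace L}) fullv ->
  z \in lie_prod (fullv : {vspace L}) fullv -> lie y z = 0.
Proof.
move=> xw; have := frame_abelian xw; case: xw => _ -> wv0.
move=> /span2P[a [b ->]] /span2P[a' [b' ->]].
rewrite !(lieDl, lieDr, lieZl, lieZr) (lieC w (lie x w)) wv0.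
by rewrite !liexx oppr0 !scaler0 !addr0.
Qed.

(* Cayley-Hamilton, ad x ^ 2 = g + d ad x on the derived algebra, makes the
   structure constants of the two frames agree. *)
Lemma frame_transitive x w x' w' :
  cyclic_frame x w -> cyclic_frame x' w' ->
  x' - x \in lie_prod (fullv : {vspace L}) fullv ->
  exists f : 'End(L),
    [/\ bijective f, forall y z, f (lie y z) = lie (f y) (f z),
        f x = x' & f w = w'].
Proof.
move=> xw xw' dx; have [[fr defD] [fr' defD']] := (xw, xw').
have [g [d def_xv]] : exists g d, lie x (lie x w) = g *: w + d *: lie x w.
  by apply: span2P; rewrite -defD mem_lie_prod ?memvf.
have wv0 : lie w (lie x w) = 0 by exact: frame_abelian.
have wv0' : lie w' (lie x' w') = 0 by exact: frame_abelian.
have def_xxv : lie x (lie x (lie x w)) = g *: lie x w + d *: lie x (lie x w).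
  by rewrite {1}def_xv lieDr !lieZr.
have ad2 y : y \in lie_prod fullv fullv ->
    lie x (lie x y) = g *: y + d *: lie x y.
  rewrite defD => /span2P[a [b ->]].
  rewrite !(lieDr, lieZr) def_xxv {1}def_xv !scalerDr !scalerA.
  rewrite ![a * _]mulrC ![b * _]mulrC.
  exact: (AC (2*2) ((1*3)*(2*4))).
(* The difference [x' - x] lies in the derived algebra, which is abelian. *)
have same_ad y : y \in lie_prod fullv fullv -> lie x' y = lie x y.
  by move=> Dy; rewrite -[x'](subrK x) lieDl (derived_abelian xw) ?add0r.
have Dw' : w' \in lie_prod fullv fullv.
  by rewrite defD' memv_span ?inE ?eqxx.
have def_xv' : lie x' (lie x' w') = g *: w' + d *: lie x' w'.
  by rewrite (same_ad w')// same_ad ?ad2// mem_lie_prod ?memvf.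
have [f] := linear_of_free [:: x; w; lie x w] [:: x'; w'; lie x' w'].
move=> /(_ fr erefl)[fx fw fv]; exists (linfun f); split; rewrite ?lfunE //=.
  have kerf : lker (linfun f) == 0%VS.
    suff : \dim (lker (linfun f)) == 0%N by rewrite dimv_eq0.
    (* The image contains the second frame, so [f] is onto; rank-nullity then makes it injective. *)
    have im_f : limg (linfun f) = fullv.
      by rewrite -{1}(frame_full fr) limg_span /= !lfunE /= fx fw fv frame_full.
    have := limg_ker_dim (linfun f) fullv; rewrite capfv im_f dimL.
    by move/eqP; rewrite -[eqbRHS]add0n eqn_add2r.
  by exists (linfun f)^-1%VF; [exact: lker0_lfunK | exact: lker0_lfunVK].
move=> y z; rewrite !lfunE /=.
have /span3P[a [b [c ->]]] : y \in <<[:: x; w; lie x w]>>%VS.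
  by rewrite frame_full ?memvf.
have /span3P[a' [b' [c' ->]]] : z \in <<[:: x; w; lie x w]>>%VS.
  by rewrite frame_full ?memvf.
(* Both frames have [[w, [x, w]] = 0] and the same [g], [d], so [f] respects the three basic
   brackets. *)
rewrite lie_comb3 !(linearD f) !(linearZ_LR f) /= fx fw fv lie_comb3.
by rewrite wv0 wv0' def_xv def_xv' linear0 !(linearD f) !(linearZ_LR f) /= fw fv.
Qed.
End Lie.

(** * Generating planes in the sum with a line *)

Section Generating.
Local Open Scope ring_scope.
Context {K : fieldType} {L : lieAlgType K}.

(** Defined for bare functions, so that it also applies to the inverse of [f], which bijectivity
    supplies only as a function. *)
Definition line_ext (f : L -> L) (z : L * K^o) : L * K^o := (f z.1, z.2).

Fact line_ext_linear (f : 'End(L)) : linear (line_ext f).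
Proof. by move=> a y z; rewrite /line_ext /= linearP. Qed.

HB.instance Definition _ (f : 'End(L)) :=
  GRing.isLinear.Build K (L * K^o)%type (L * K^o)%type *:%R (line_ext f)
    (line_ext_linear f).

Definition left_incl (y : L) : L * K^o := (y, 0).

Fact left_incl_linear : linear left_incl.
Proof. by move=> a y z; congr pair; rewrite /= scaler0 addr0. Qed.

HB.instance Definition _ :=
  GRing.isLinear.Build K L (L * K^o)%type *:%R left_incl left_incl_linear.

Lemma lie_pairE (y z : L * K^o) : lie y z = left_incl (lie y.1 z.1).
Proof. by []. Qed.

Lemma line_ext_automorphism (f : 'End(L)) :
  lie_automorphism f -> lie_automorphism (linfun (line_ext f)).
Proof.
case=> -[g gK Kg] fM; split=> [|y z]; last first.
  by rewrite !lfunE /= /line_ext !lie_pairE /= fM.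
exists (line_ext g) => -[y s]; first by rewrite lfunE /line_ext /= gK.
by rewrite lfunE /= {1}/line_ext /= Kg.
Qed.

Local Notation D := (lie_prod (fullv : {vspace L}) fullv).

Context (dimL : \dim (fullv : {vspace L}) = 3%N).

Lemma dim_line_ext : \dim (fullv : {vspace L * K^o}) = 4%N.
Proof.
by rewrite dimvf -[RHS]/(3 + 1)%N -dimL dimvf.
Qed.

(** Otherwise the derived series would be constant and never reach zero. *)
Lemma solvable_derived_proper : lie_solvable L -> D <> fullv.
Proof.
case=> n nil eqD.
have : derived_series L n = fullv.
  elim: n {nil} => [//|n IHn].
  by rewrite /derived_series iterS -/(derived_series L n) IHn.
by rewrite nil => L0; move: dimL; rewrite -L0 dimv0.
Qed.

(** Fixing [e] beforehand makes the vectors [x] obtained from different planes congruent modulo [D],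
    as [frame_transitive] requires. *)
Lemma generating_frame (V : {vspace L * K^o}) (e : L) :
  e \notin D -> \dim V = 2%N -> generating V ->
  exists x w, [/\ cyclic_frame x w, x - e \in D &
    V = (<[(x, 0%R) : L * K^o]> + <[(w, 1%R) : L * K^o]>)%VS].
Proof.
move=> nDe dimV [_ _ genV].
pose D0 := (linfun left_incl @: D)%VS.
have memD0 y : y \in D -> ((y, 0) : L * K^o) \in D0.
  by move=> Dy; rewrite -[(y, 0)]/(left_incl y) -lfunE memv_img.
(* The sum contains every bracket, hence is a subalgebra containing [V]. *)
have VD0 : (V + D0)%VS = fullv.
  apply/subv_anti; rewrite subvf genV ?addvSl// => y z _ _.
  by apply: (subvP (addvSr V D0)); rewrite lie_pairE memD0 ?mem_lie_prod ?memvf.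
have leD : (\dim D <= 2)%N.
  rewrite leqNgt; apply/negP => ltD; move/negP: nDe; apply.
  suff /eqP-> : D == fullv by rewrite memvf.
  by rewrite eqEdim subvf dimL.
have decomp y s : exists2 d, d \in D & ((y - d, s) : L * K^o) \in V.
  have: ((y, s) : L * K^o) \in (V + D0)%VS by rewrite VD0 memvf.
  case/memv_addP=> v Vv [_ /memv_imgP[d Dd ->]]; rewrite lfunE /= => def_ys.
  exists d => //; suff -> : (y - d, s) = v by [].
  rewrite -[v](addrK (left_incl d)) -def_ys.
  by congr pair; rewrite subr0.
have [d Dd Vx] := decomp e 0; have [d' Dd' Vw] := decomp 0 1.
pose x := e - d; pose w := - d'.
rewrite -/x sub0r -/w in Vx Vw.
have Dw : w \in D by rewrite rpredN.
have nDx : x \notin D by apply: contra nDe => Dx; rewrite -[e](subrK d) rpredD.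
have free_xw : free [:: ((x, 0) : L * K^o); ((w, 1) : L * K^o)].
  rewrite free_cons span_seq1 seq1_free; apply/andP; split; last first.
    by apply/eqP => -[_ /eqP]; rewrite oner_eq0.
  by apply: contra nDx => /vlineP[k [-> _]]; rewrite rpredZ.
have defV : V = (<[(x, 0%R) : L * K^o]> + <[(w, 1%R) : L * K^o]>)%VS.
  apply/esym/eqP; rewrite -[X in (_ + X)%VS]span_seq1 -span_cons eqEdim.
  rewrite dimV (eqP free_xw) andbT.
  by apply/span_subvP => y; rewrite !inE => /orP[]/eqP->.
have nxw : lie x w \notin <[w]>%VS.
  apply/vlineP => -[k def_xw].
  (* If [w] were an eigenvector of [ad x], the only possibly nonzero bracket among these three
     vectors would be a multiple of [(w, 0)], so their span would be a subalgebra of dimension at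
     most 3 in a space of dimension 4. *)
  pose s := [:: ((x, 0) : L * K^o); ((0, 1) : L * K^o); ((w, 0) : L * K^o)].
  suff : (fullv <= <<s>>)%VS.
    by move/dimvS; rewrite dim_line_ext => /leq_trans/(_ (dim_span s)).
  apply: genV => [y z|].
    move=> /span3P[a [b [c ->]]] /span3P[a' [b' [c' ->]]].
    rewrite lie_comb3 !lie_pairE /= def_xw lie0r (lieC w 0) lie0r oppr0.
    rewrite linear0 linearZ !scaler0 add0r addr0 /=.
    by rewrite !rpredZ// memv_span// !inE eqxx ?orbT.
  have sP z : z \in s -> z \in <<s>>%VS by exact: memv_span.
  rewrite defV subv_add -!memvE sP ?inE ?eqxx//=.
  suff -> : (w, 1) = ((0, 1) + (w, 0) : L * K^o).
    by rewrite rpredD// sP// !inE eqxx ?orbT.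
  by congr pair; rewrite /= ?add0r ?addr0.
have free_w : free [:: w; lie x w].
  (* With [[x, w]] in front, freeness is [nxw] together with [w <> 0], which [nxw] also implies
     since [[x, 0] = 0]. *)
  rewrite (perm_free (_ : perm_eq _ [:: lie x w; w])); last first.
    by rewrite (perm_catC [:: w] [:: lie x w]).
  rewrite free_cons span_seq1 nxw seq1_free.
  by apply: contra nxw => /eqP->; rewrite lie0r mem0v.
have defD : D = <<[:: w; lie x w]>>%VS.
  apply/esym/eqP; rewrite eqEdim (eqP free_w) leD andbT.
  apply/span_subvP => y; rewrite !inE => /orP[]/eqP-> //.
  by rewrite mem_lie_prod ?memvf.
exists x, w; split=> //; last by rewrite addrAC subrr add0r rpredN.
by split=> //; rewrite free_cons -defD nDx.
Qed.

End Generating.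

(** * Transitivity of automorphisms on generating planes *)

Theorem corollary1 (R : realType) (g3 : lieAlgType R) :
  \dim (fullv : {vspace g3}) = 3 ->
  lie_solvable g3 ->
  lie_indecomposable g3 ->
  forall V W : {vspace (g3 * R^o)%type},
    \dim V = 2 -> \dim W = 2 ->
    generating V -> generating W ->
    exists phi : 'End((g3 * R^o)%type),
      lie_automorphism phi /\ (phi @: V)%VS = W.
Proof.
move=> dimL /(solvable_derived_proper dimL) properD _ V W dimV dimW genV genW.
have [e _ nDe] : exists2 e,
    e \in (fullv : {vspace g3}) & e \notin lie_prod fullv fullv.
  by apply/subvPn/negP => sD; apply: properD; apply/subv_anti; rewrite subvf.
have [x [w [xw Dx ->]]] := generating_frame dimL nDe dimV genV.
have [x' [w' [xw' Dx' ->]]] := generating_frame dimL nDe dimW genW.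
have [|f [bijf fM fx fw]] := frame_transitive dimL xw xw'.
  (* Here [x' - x = (x' - e) - (x - e)], a difference of two elements of the derived algebra. *)
  by rewrite -[x'](subrK e) -addrA rpredD// -opprB rpredN.
exists (linfun (line_ext f)); split; first exact: line_ext_automorphism.
by rewrite limgD !limg_line !lfunE /= /line_ext /= fx fw.
Qed.
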